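(* Let $n, k \geq 1$ be integers, and fix vectors $u_1, y_1, \dots, u_k, y_k \in \mathbb{C}^n$ such that $$\mathbf{w} := (u_1 \circ y_1) \circ \cdots \circ (u_k \circ y_k)$$ is nonzero. Then we have the (rank $\leq 1$) lower bound: for all positive semidefinite matrices $M_1, \dots, M_k \in \mathbb{C}^{n \times n}$, $$\left( D_{u_1} M_1 D_{u_1}^* \circ D_{y_1} \overline{M_1} D_{y_1}^* \right) \circ \cdots \circ \left( D_{u_k} M_k D_{u_k}^* \circ D_{y_k} \overline{M_k} D_{y_k}^* \right) \ \geq \ \frac{1}{\operatorname{rk}(M_{J(\mathbf{w}) \times J(\mathbf{w})})} (\mathbf{w} \circ d_{M_1} \circ \cdots \circ d_{M_k}) (\mathbf{w} \circ d_{M_1} \circ \cdots \circ d_{M_k})^*,$$ where $M := M_1 \circ \cdots \circ M_k$. (If the principal submatrix $M_{J(\mathbf{w}) \times J(\mathbf{w})} = \mathbf{0}$, then $\mathbf{w} \circ d_{M_1} \circ \cdots \circ d_{M_k}$ is also zero, so the coefficient is irrelevant.) Moreover, the coefficient $\frac{1}{\operatorname{rk}(M_{J(\mathbf{w}) \times J(\mathbf{w})})}$ is best possible for all $u_j, y_j \in \mathbb{C}^n$ for which $\mathbf{w} \neq 0$, and all $M_1, \dots, M_k$ for which $M_{J(\mathbf{w}) \times J(\mathbf{w})} \neq \mathbf{0}$.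
   Context: A positive semidefinite matrix is a complex Hermitian matrix with non-negative eigenvalues. For matrices or vectors of the same size, $\circ$ denotes the Schur (entrywise) product. For $n \times n$ complex matrices $X, Y$, $X \geq Y$ (Loewner ordering) means that $X - Y$ is positive semidefinite. For $u = (u_1,\dots,u_n)^T \in \mathbb{C}^n$, $D_u$ is the diagonal matrix with diagonal entries $u_1, \dots, u_n$, and $J(u) := \{ j : 1 \leq j \leq n,\ u_j \neq 0\}$. For a square matrix $M=(m_{jk})$, $d_M := (m_{11}, \dots, m_{nn})^T$ is the vector of its diagonal entries, $\overline{M}$ is the entrywise complex conjugate, $M^*$ is the conjugate transpose, and $M_{J \times J}$ is the principal submatrix with rows and columns indexed by $J$; $\operatorname{rk}$ denotes rank.
   Formalization: ''Best possible'' is false for each individual choice of M_j (n=2, k=1, u=y=(1,1), M=[[2,1],[1,2]] allows 5/8 > 1/2); it is stated as: for fixed u_j, y_j, no larger coefficient works for all positive semidefinite families with the same rank of the principal submatrix. *)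

(* Defs.v *)
From mathcomp Require Import all_boot all_order all_algebra.
From mathcomp Require Import reals complex.

Set Implicit Arguments.
Unset Strict Implicit.
Unset Printing Implicit Defensive.

Import Order.TTheory GRing.Theory Num.Theory.

Local Open Scope ring_scope.
Local Open Scope complex_scope.
Local Open Scope sesquilinear_scope.

Section Definitions.
Variable R : realType.
Local Notation C := R[i].

Definition psd n (M : 'M[C]_n) : Prop :=
  M^t* = M /\ forall a : C, eigenvalue M a -> 0 <= a.

Definition loewner_ge n (X Y : 'M[C]_n) : Prop := psd (X - Y).

Definition schur m n (A B : 'M[C]_(m, n)) : 'M[C]_(m, n) := map2_mx *%R A B.

(* The all-ones matrix is the unit of the Schur product. *)
Definition bigschur m n k (F : 'I_k -> 'M[C]_(m, n)) : 'M[C]_(m, n) :=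
  \big[@schur m n/const_mx 1]_(i < k) F i.

Definition Dmx n (u : 'cV[C]_n) : 'M[C]_n := diag_mx u^T.

Definition diagv n (M : 'M[C]_n) : 'cV[C]_n := \col_i M i i.

Definition conjmatrix m n (M : 'M[C]_(m, n)) : 'M[C]_(m, n) := map_mx Num.conj M.

Definition Jset n (u : 'cV[C]_n) : {set 'I_n} := [set j | u j 0 != 0].

(* enum_val lists the elements of J in increasing order. *)
Definition principal n (J : {set 'I_n}) (M : 'M[C]_n) : 'M[C]_#|J| :=
  mxsub (fun a : 'I_#|J| => enum_val a) (fun a : 'I_#|J| => enum_val a) M.

Definition wvec n k (u y : 'I_k -> 'cV[C]_n) : 'cV[C]_n :=
  bigschur (fun i => schur (u i) (y i)).

Definition lhs n k (u y : 'I_k -> 'cV[C]_n) (M : 'I_k -> 'M[C]_n) : 'M[C]_n :=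
  bigschur (fun i =>
    schur (Dmx (u i) *m M i *m (Dmx (u i))^t*)
          (Dmx (y i) *m conjmatrix (M i) *m (Dmx (y i))^t*)).

Definition wdvec n k (u y : 'I_k -> 'cV[C]_n) (M : 'I_k -> 'M[C]_n) : 'cV[C]_n :=
  schur (wvec u y) (bigschur (fun i => diagv (M i))).

Definition wprincipal n k (u y : 'I_k -> 'cV[C]_n) (M : 'I_k -> 'M[C]_n) :
    'M[C]_#|Jset (wvec u y)| :=
  principal (Jset (wvec u y)) (bigschur M).

Definition lower_bound n k (u y : 'I_k -> 'cV[C]_n) (M : 'I_k -> 'M[C]_n)
    (c : R) : Prop :=
  loewner_ge (lhs u y M) (c%:C *: (wdvec u y M *m (wdvec u y M)^t*)).

End Definitions.

(* Main.v *)
(* Writing S for the Schur product of the M_i, the left side has entries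
   w_p conj(w_q) |S_pq|^2.  Testing against a row vector v and setting
   x_p = v_p w_p, which is supported on J(w), the bound becomes
   |tr(X P)|^2 <= rk(P) tr(X P X^* P) for X = diag(x) and the principal block
   P of S on J(w).  Factoring P = B B^* with rk(P) columns, this is
   Cauchy-Schwarz between the diagonal of the square matrix B^* X B and the
   all-ones vector.  Equality at v = 1/w occurs for coordinate projections. *)
Require Import Defs.
From mathcomp Require Import all_boot all_order all_algebra.
From mathcomp Require Import reals complex ring.

Set Implicit Arguments.
Unset Strict Implicit.
Unset Printing Implicit Defensive.

Import Order.TTheory GRing.Theory Num.Theory.

Local Open Scope ring_scope.
Local Open Scope complex_scope.
Section PositiveSemidefinite.
Local Open Scope sesquilinear_scope.
Variable R : realType.
Local Notation C := R[i].

(** * Quadratic forms and Gram factorizations *)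

Lemma qformE n (v : 'rV[C]_n) (M : 'M[C]_n) :
  (v *m M *m v^t*) 0 0 =
  \sum_p \sum_q v 0 p * Num.conj (v 0 q) * M p q.
Proof.
rewrite mxE exchange_big /=; apply: eq_bigr => q _.
rewrite !mxE mulr_suml; apply: eq_bigr => p _.
by rewrite mulrAC.
Qed.

Lemma dotv_gt0 n (v : 'rV[C]_n) : v != 0 -> 0 < (v *m v^t*) 0 0.
Proof. by rewrite -dotmxE; exact: dotmx_is_dotmx. Qed.

Lemma dotv_ge0 n (v : 'rV[C]_n) : 0 <= (v *m v^t*) 0 0.
Proof. by have [->|/dotv_gt0/ltW//] := eqVneq v 0; rewrite mul0mx mxE. Qed.

Lemma trmxC_mul m n p (A : 'M[C]_(m, n)) (B : 'M[C]_(n, p)) :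
  (A *m B)^t* = B^t* *m A^t*.
Proof. by rewrite trmx_mul map_mxM. Qed.

Lemma qform_psd n (M : 'M[C]_n) :
  M^t* = M -> (forall v : 'rV_n, 0 <= (v *m M *m v^t*) 0 0) -> psd M.
Proof.
move=> hM M_ge0; split=> // a /eigenvalueP[v vM vN0].
have := M_ge0 v; rewrite vM -scalemxAl mxE.
by rewrite pmulr_lge0 ?dotv_gt0.
Qed.

Lemma gram_psd m n (B : 'M[C]_(m, n)) : psd (B *m B^t*).
Proof.
apply: qform_psd => [|v]; first by rewrite trmxC_mul trmxCK.
by rewrite mulmxA -mulmxA -trmxC_mul dotv_ge0.
Qed.

(** Unitary diagonalization gives M = P^* diag(d) P with d nonnegative, and B = P^* diag(sqrt d) is
    a factor. *)
Lemma psd_gram n (M : 'M[C]_n) :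
  psd M -> exists B : 'M[C]_n, M = B *m B^t*.
Proof.
case=> hM eM.
have hermM : M \is hermsymmx.
  by apply/is_hermitianmxP; rewrite expr0 scale1r.
set P := spectralmx M; set d := spectral_diag M.
have PU : P \is unitarymx by exact: spectral_unitarymx.
have ME : M = P^t* *m diag_mx d *m P.
  rewrite -invmx_unitary //.
  exact/orthomx_spectralP/hermitian_normalmx.
have PM : P *m M = diag_mx d *m P.
  by rewrite {1}ME !mulmxA (unitarymxP PU) mul1mx.
(* Row i of [P] is an eigenvector for [d 0 i]; it is nonzero because it has norm 1. *)
have d_ge0 i : 0 <= d 0 i.
  apply: eM; apply/eigenvalueP; exists (row i P).
    by rewrite -row_mul PM mul_diag_mx; apply/rowP => j; rewrite !mxE.
  apply/eqP => P0; have /row_unitarymxP/(_ i i) := PU.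
  by rewrite P0 dotmxE mul0mx mxE eqxx => /eqP; rewrite eq_sym oner_eq0.
exists (P^t* *m diag_mx (map_mx sqrtC d)).
rewrite trmxC_mul trmxCK tr_diag_mx map_diag_mx mulmxA -(mulmxA (P^t*)).
rewrite mulmx_diag [LHS]ME; congr (_ *m diag_mx _ *m _).
by apply/rowP => i; rewrite !mxE -normCK ger0_norm ?sqrtC_ge0 ?sqrtCK.
Qed.

Lemma psd_qform n (M : 'M[C]_n) (v : 'rV_n) :
  psd M -> 0 <= (v *m M *m v^t*) 0 0.
Proof.
by case/psd_gram=> B ->; rewrite mulmxA -mulmxA -trmxC_mul dotv_ge0.
Qed.

(** Orthonormalizing a row basis of M gives [S] with S S^* = 1 and M S^* S = M. The compression S M
    S^* has size [\rank M]; its square Gram factor [H] lifts to the factor S^* H of M. *)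
Lemma psd_rank_gram n (M : 'M[C]_n) :
  psd M -> exists B : 'M[C]_(n, \rank M), M = B *m B^t*.
Proof.
move=> psdM; have [hM _] := psdM.
have [S SU /submxP[W MW]] :
    exists2 S : 'M[C]_(\rank M, n), S \is unitarymx & (M <= S)%MS.
  exists (schmidt (row_base M)); first by rewrite schmidt_unitarymx ?rank_leq_col.
  by rewrite -(eq_row_base M) schmidt_sub.
move: (\rank M) S SU W MW => r S SU W MW.
have MS : M *m S^t* *m S = M.
  by rewrite {1}MW -(mulmxA W) (unitarymxP SU) mulmx1 -MW.
have SM : S^t* *m S *m M = M.
  by rewrite -[in RHS]hM -[in RHS]MS !trmxC_mul trmxCK hM mulmxA.
have [G GE] := psd_gram psdM.
have [|H HE] := @psd_gram _ (S *m M *m S^t*).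
  rewrite GE -mulmxA; have -> : G *m G^t* *m S^t* = G *m (S *m G)^t*.
    by rewrite trmxC_mul mulmxA.
  by rewrite mulmxA; apply: gram_psd.
exists (S^t* *m H).
by rewrite trmxC_mul trmxCK mulmxA -(mulmxA _ H) -HE !mulmxA SM MS.
Qed.

(** * Cauchy-Schwarz and the trace inequality *)

Lemma CauchySchwarz_sum n (z : 'I_n -> C) :
  `|\sum_i z i| ^+ 2 <= n%:R * \sum_i `|z i| ^+ 2.
Proof.
pose v : 'rV[C]_n := \row_i z i; pose e : 'rV[C]_n := const_mx 1.
have [CS _] := CauchySchwarz (@dotmx C n) v e; move: CS; rewrite /= !dotmxE.
have -> : (v *m e^t*) 0 0 = \sum_i z i.
  by rewrite mxE; apply: eq_bigr => i _; rewrite !mxE rmorph1 mulr1.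
have -> : (v *m v^t*) 0 0 = \sum_i `|z i| ^+ 2.
  by rewrite mxE; apply: eq_bigr => i _; rewrite !mxE -normCK.
suff -> : (e *m e^t*) 0 0 = n%:R by rewrite mulrC.
rewrite mxE (eq_bigr (fun=> 1)) => [|i _]; first by rewrite sumr_const card_ord.
by rewrite !mxE rmorph1 mulr1.
Qed.

Lemma psd_conj n (M : 'M[C]_n) p q : psd M -> Num.conj (M p q) = M q p.
Proof. by case=> hM _; rewrite -[in RHS]hM !mxE. Qed.

(* With M = B B* and B having \rank M columns, the left sum is the trace of
   the square matrix G = B* diag(x) B of size \rank M, and the right one is
   the squared Frobenius norm of G. *)
Lemma psd_diag_bound n (M : 'M[C]_n) (x : 'I_n -> C) : psd M ->
  (\rank M)%:R^-1 * `|\sum_p x p * M p p| ^+ 2 <=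
  \sum_p \sum_q x p * Num.conj (x q) * `|M p q| ^+ 2.
Proof.
move=> psdM; have [B] := psd_rank_gram psdM; set r := \rank M in B * => ME.
pose X : 'M[C]_n := diag_mx (\row_p x p).
pose G : 'M[C]_r := B^t* *m X *m B.
have -> : \sum_p x p * M p p = \tr G.
  rewrite /G -mulmxA mxtrace_mulC -mulmxA -ME mul_diag_mx.
  by apply: eq_bigr => p _; rewrite !mxE.
have -> : \sum_p \sum_q x p * Num.conj (x q) * `|M p q| ^+ 2 =
    \sum_i \sum_j `|G i j| ^+ 2.
  transitivity (\tr (G *m G^t*)); last first.
    apply: eq_bigr => i _; rewrite mxE; apply: eq_bigr => j _.
    by rewrite normCK; congr (_ * _); rewrite 2!mxE.
  have -> : G *m G^t* = B^t* *m (X *m M *m X^t* *m B).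
    by rewrite ME /G !trmxC_mul trmxCK !mulmxA.
  rewrite mxtrace_mulC -(mulmxA _ B) -ME tr_diag_mx map_diag_mx.
  rewrite mul_diag_mx mul_mx_diag; apply: eq_bigr => p _; rewrite mxE.
  apply: eq_bigr => q _; rewrite normCK psd_conj // !mxE.
  by rewrite -!mulrA; congr (_ * _); rewrite mulrCA.
have sum_ge0 : 0 <= \sum_i \sum_j `|G i j| ^+ 2.
  by apply: sumr_ge0 => i _; apply: sumr_ge0 => j _; rewrite exprn_ge0.
(* For rank 0 the inverse is 0 by convention, leaving only nonnegativity of the right side. *)
have [r0|r_gt0] := posnP r.
  by rewrite (_ : r%:R^-1 = 0) ?mul0r // r0 invr0.
rewrite ler_pdivrMl ?ltr0n //; apply: le_trans (CauchySchwarz_sum _) _.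
rewrite ler_pM2l ?ltr0n //; apply: ler_sum => i _.
by rewrite (bigD1 i) //= lerDl sumr_ge0 // => j _; rewrite exprn_ge0.
Qed.

(** * Schur products and principal submatrices *)

Lemma bigschurE m n k (F : 'I_k -> 'M[C]_(m, n)) p q :
  bigschur F p q = \prod_(i < k) F i p q.
Proof.
by rewrite /bigschur; elim/big_rec2: _ => [|i a A _ <-]; rewrite !mxE.
Qed.

(** If A = G G^*, the form of the Schur product at v is the sum, over the columns g of G, of the
    form of B at the entrywise product of v and g. *)
Lemma schur_psd n (A B : 'M[C]_n) : psd A -> psd B -> psd (schur A B).
Proof.
move=> psdA psdB; apply: qform_psd => [|v].
  by apply/matrixP => p q; rewrite !mxE rmorphM /= !psd_conj.
have [G AE] := psd_gram psdA; rewrite qformE.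
rewrite (_ : \sum_p _ = \sum_l
    ((\row_p (v 0 p * G p l)) *m B *m (\row_p (v 0 p * G p l))^t*) 0 0).
  by apply: sumr_ge0 => l _; apply: psd_qform.
under [RHS]eq_bigr do rewrite qformE.
rewrite [RHS]exchange_big; apply: eq_bigr => p _ /=.
rewrite [RHS]exchange_big; apply: eq_bigr => q _ /=.
rewrite !mxE AE mxE mulr_suml mulr_sumr; apply: eq_bigr => l _.
by rewrite !mxE rmorphM /=; ring.
Qed.

Lemma bigschur_psd n k (F : 'I_k -> 'M[C]_n) :
  (forall i, psd (F i)) -> psd (bigschur F).
Proof.
move=> psdF; apply: (big_ind (@psd R n)); last by move=> i _; exact: psdF.
  have -> : const_mx 1 = (const_mx 1 : 'cV[C]_n) *m (const_mx 1 : 'cV[C]_n)^t*.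
    by apply/matrixP => p q; rewrite !mxE big_ord1 !mxE rmorph1 mulr1.
  exact: gram_psd.
exact: schur_psd.
Qed.

Lemma principal_psd n (J : {set 'I_n}) (M : 'M[C]_n) :
  psd M -> psd (principal J M).
Proof.
case/psd_gram=> B ->; rewrite /principal mxsub_mul.
have -> : colsub (fun a : 'I_#|J| => enum_val a) (B^t*) =
    (rowsub (fun a : 'I_#|J| => enum_val a) B)^t*.
  by apply/matrixP => i j; rewrite !mxE.
exact: gram_psd.
Qed.

Lemma big_enum_val_support n (A : {set 'I_n}) (F : 'I_n -> C) :
  (forall p, p \notin A -> F p = 0) ->
  \sum_p F p = \sum_(a < #|A|) F (enum_val a).
Proof.
move=> F0; rewrite -(big_enum_val F) [LHS](bigID [in A]) /=.
by rewrite [X in _ + X]big1 ?addr0.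
Qed.

Lemma Dmx_conjE n (a : 'cV[C]_n) (A : 'M[C]_n) p q :
  (Dmx a *m A *m (Dmx a)^t*) p q = a p 0 * A p q * Num.conj (a q 0).
Proof.
by rewrite /Dmx tr_diag_mx map_diag_mx mul_mx_diag mul_diag_mx !mxE.
Qed.

(** * The lower bound and its sharpness *)

Section Bound.
Variables (n k : nat) (u y : 'I_k -> 'cV[C]_n).
Local Notation w := (wvec u y).
Local Notation J := (Jset w).

Lemma lhsE M p q :
  lhs u y M p q = w p 0 * Num.conj (w q 0) * `|bigschur M p q| ^+ 2.
Proof.
rewrite normCK !bigschurE !rmorph_prod -!big_split /=; apply: eq_bigr => i _.
rewrite mxE !Dmx_conjE !mxE.
by rewrite rmorphM /=; ring.
Qed.

Lemma wdvecE M p : wdvec u y M p 0 = w p 0 * bigschur M p p.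
Proof.
by rewrite mxE !bigschurE; congr (_ * _); apply: eq_bigr => i _; rewrite mxE.
Qed.

(** Scalar form of the Loewner inequality, used both to prove the bound and to test a candidate
    constant: the rank-one term becomes the squared modulus of a linear form in v. *)
Lemma lower_boundP M c : (forall i, psd (M i)) ->
  lower_bound u y M c <-> forall v : 'I_n -> C,
    c%:C * `|\sum_p v p * w p 0 * bigschur M p p| ^+ 2 <=
    \sum_p \sum_q (v p * w p 0) * Num.conj (v q * w q 0)
                  * `|bigschur M p q| ^+ 2.
Proof.
move=> psdM.
have psdS := bigschur_psd psdM.
pose D := lhs u y M - c%:C *: (wdvec u y M *m (wdvec u y M)^t*).
have DE (v : 'rV_n) : (v *m D *m v^t*) 0 0 =
    \sum_p \sum_q (v 0 p * w p 0) * Num.conj (v 0 q * w q 0)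
                  * `|bigschur M p q| ^+ 2
    - c%:C * `|\sum_p v 0 p * w p 0 * bigschur M p p| ^+ 2.
  rewrite mulmxBr mulmxBl mxE; congr (_ + _).
    rewrite qformE; apply: eq_bigr => p _; apply: eq_bigr => q _.
    by rewrite lhsE rmorphM /=; ring.
  rewrite mxE -scalemxAr -scalemxAl mxE mulmxA -(mulmxA (v *m _)) -trmxC_mul.
  have -> (a : 'M[C]_1) : (a *m a^t*) 0 0 = `|a 0 0| ^+ 2.
    by rewrite mxE big_ord1 normCK !mxE.
  rewrite mxE; congr (- (_ * `|_| ^+ 2)).
  by apply: eq_bigr => p _; rewrite wdvecE mulrA.
split=> [psdD v|le_v].
  have := psd_qform (\row_p v p) psdD; rewrite -/D DE subr_ge0.
  under eq_bigr do rewrite mxE.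
  under [X in _ <= X -> _]eq_bigr do under eq_bigr do rewrite !mxE.
  by [].
apply: qform_psd => [|v]; last by rewrite -/D DE subr_ge0.
(* The difference is Hermitian: |S_qp| = |S_pq| for the Schur product S of the [M i], and [c] is
   real. *)
rewrite /D linearB /= map_mxB linearZ /= map_mxZ trmxC_mul trmxCK.
congr (_ - _ *: _).
  apply/matrixP => p q; rewrite !mxE !lhsE.
  have -> : `|bigschur M q p| = `|bigschur M p q|.
    by rewrite -(psd_conj p q psdS) norm_conjC.
  have conj_sq : Num.conj (`|bigschur M p q| ^+ 2) = `|bigschur M p q| ^+ 2.
    by rewrite geC0_conj // exprn_ge0.
  by rewrite rmorphM /= conj_sq rmorphM /= conjCK (mulrC (w p 0)).
exact: conjc_real.
Qed.

(** [psd_diag_bound] applies to the principal block with weights v_p w_p; all sums restrict to [J]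
    because w vanishes off it. *)
Lemma rank_lower_bound M : (forall i, psd (M i)) ->
  lower_bound u y M (\rank (wprincipal u y M))%:R^-1.
Proof.
move=> psdM; apply/lower_boundP => // v.
have psdP := principal_psd J (bigschur_psd psdM).
have := psd_diag_bound (fun a => v (enum_val a) * w (enum_val a) 0) psdP.
rewrite fmorphV rmorph_nat -/(wprincipal u y M).
have w0 p : p \notin J -> w p 0 = 0 by rewrite inE negbK => /eqP.
rewrite (big_enum_val_support (A := J)) => [|p /w0->]; last by rewrite mulr0 mul0r.
rewrite [X in _ -> _ <= X](big_enum_val_support (A := J)) => [|p /w0->]; last first.
  by rewrite big1 // => q _; rewrite mulr0 !mul0r.
under eq_bigr do rewrite mxE.
under [X in _ <= X -> _]eq_bigr do under eq_bigr do rewrite mxE.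
under [X in _ -> _ <= X]eq_bigr => a _.
  rewrite (big_enum_val_support (A := J)) => [|q /w0->]; last first.
    by rewrite mulr0 rmorph0 mulr0 mul0r.
  over.
by [].
Qed.

Lemma wprincipal0 M : wprincipal u y M = 0 -> wdvec u y M = 0.
Proof.
move=> P0; apply/colP => p; rewrite wdvecE mxE.
have [->|wp] := eqVneq (w p 0) 0; first by rewrite mul0r.
have Jp : p \in J by rewrite inE.
have /matrixP/(_ (enum_rank_in Jp p) (enum_rank_in Jp p)) := P0.
by rewrite !mxE enum_rankK_in // => ->; rewrite mulr0.
Qed.

(* The projection onto the first r coordinates in J has principal block
   pid_mx r, and turns the inequality at v = w^-1 into c r^2 <= r. *)
Lemma rank_lower_bound_sharp (c : R) r : (0 < k)%N -> (0 < r <= #|J|)%N ->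
  (forall N : 'I_k -> 'M[C]_n, (forall i, psd (N i)) ->
     \rank (wprincipal u y N) = r -> lower_bound u y N c) ->
  c <= r%:R^-1.
Proof.
move=> k_gt0 /andP[r_gt0 rJ] lbc.
(* [t] selects the first [r] elements of [J] in the order in which [principal] lists them. *)
pose t p : bool := (p \in J) && (index p (enum J) < r)%N.
pose E : 'M[C]_n := diag_mx (\row_p (t p)%:R).
have EE p q : E p q = ((p == q) && t p)%:R.
  by rewrite !mxE; case: eqVneq; case: (t p).
have psdE : psd E.
  have -> : E = E *m E^t*; last exact: gram_psd.
  rewrite tr_diag_mx map_diag_mx mulmx_diag; congr diag_mx.
  by apply/rowP => p; rewrite !mxE rmorph_nat -natrM mulnb andbb.
(* 0/1 entries are idempotent; k > 0 excludes the empty product, which is all ones. *)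
have SE : bigschur (fun _ : 'I_k => E) = E.
  apply/matrixP => p q; rewrite bigschurE prodr_const card_ord EE.
  by case: (_ && _); rewrite ?expr1n // expr0n gtn_eqF.
have rankE : \rank (wprincipal u y (fun=> E)) = r.
  rewrite -[RHS](@rank_pid_mx C #|J| #|J| r) //; congr (\rank _).
  apply/matrixP => a b; rewrite /wprincipal SE mxE EE [RHS]mxE.
  rewrite (inj_eq enum_val_inj) /t enum_valP /=.
  by rewrite [enum_val a](enum_val_nth (enum_val a)) index_uniq ?enum_uniq -?cardE.
have sum_t : \sum_p (t p)%:R = r%:R :> C.
  rewrite (big_enum_val_support (A := J)) => [|p /negPf]; last by rewrite /t => ->.
  rewrite (eq_bigr (fun a : 'I_#|J| => if (a < r)%N then 1 else 0)) => [|a _].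
    rewrite -big_mkcond -(big_ord_widen _ (fun=> 1)) //.
    by rewrite sumr_const card_ord.
  rewrite /t enum_valP /= [enum_val a](enum_val_nth (enum_val a)).
  by rewrite index_uniq ?enum_uniq -?cardE //; case: ifP.
have tw p : t p -> (w p 0)^-1 * w p 0 = 1.
  by case/andP; rewrite inE => wp _; rewrite mulVf.
have /lower_boundP/(_ (fun p => (w p 0)^-1)) := lbc _ (fun=> psdE) rankE.
move/(_ (fun=> psdE)); rewrite SE.
rewrite [X in `|X|](_ : _ = r%:R); last first.
  rewrite -sum_t; apply: eq_bigr => p _; rewrite EE eqxx.
  by have [/tw->|_] := boolP (t p); rewrite ?mul1r ?mulr0.
(* [E] is diagonal, so only the terms p = q survive, each equal to 1 or 0 according to [t p]. *)
rewrite [X in _ <= X](_ : _ = r%:R); last first.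
  rewrite -sum_t; apply: eq_bigr => p _; rewrite (bigD1 p) //= big1 => [|q].
    rewrite EE eqxx addr0; have [/tw->|_] := boolP (t p).
      by rewrite rmorph1 normr1 expr1n !mulr1.
    by rewrite normr0 expr0n mulr0.
  by rewrite eq_sym EE => /negPf->; rewrite normr0 expr0n mulr0.
rewrite normr_nat -[r%:R](rmorph_nat (real_complex R)) -rmorphXn -rmorphM.
rewrite lecR expr2 mulrA ger_pMl ?ltr0n //.
by rewrite -ler_pdivlMr ?ltr0n // div1r.
Qed.
End Bound.
End PositiveSemidefinite.

Theorem theorem1p22 (R : realType) (n k : nat) (hn : (1 <= n)%N) (hk : (1 <= k)%N)
    (u y : 'I_k -> 'cV[R[i]]_n) (hw : wvec u y != 0) :
  (* the bound, and the degenerate case *)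
  (forall M : 'I_k -> 'M[R[i]]_n, (forall i, psd (M i)) ->
     lower_bound u y M (\rank (wprincipal u y M))%:R^-1
     /\ (wprincipal u y M = 0 -> wdvec u y M = 0))
  (* no larger constant is valid for all families with the same rank *)
  /\ (forall M : 'I_k -> 'M[R[i]]_n, (forall i, psd (M i)) ->
     wprincipal u y M <> 0 ->
     forall c : R,
       (forall N : 'I_k -> 'M[R[i]]_n, (forall i, psd (N i)) ->
          \rank (wprincipal u y N) = \rank (wprincipal u y M) ->
          lower_bound u y N c) ->
       c <= (\rank (wprincipal u y M))%:R^-1).
Proof.
split=> [M psdM|M psdM P_neq0 c].
  by split; [exact: rank_lower_bound | exact: wprincipal0].
apply: rank_lower_bound_sharp => //.
(* A nonzero block has rank between 1 and [#|J|], the range in which the projection exists. *)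
by rewrite rank_leq_row lt0n mxrank_eq0 andbT; apply/eqP.
Qed.
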